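(* Let $n\ge 1$ be an integer. The Jacobi sequence of $\dfrac{e^{2/n}+1}{e^{2/n}-1}$ (where $e$ is Euler's number) is purely periodic, and its smallest period length is $24$ if $n\equiv 1,3\pmod 4$, $8$ if $n\equiv 2\pmod 4$, and $2$ if $n\equiv 0\pmod 4$.
   Context: For $x\in\mathbb{R}\setminus\mathbb{Q}$ with regular continued fraction expansion $x=[a_0,a_1,a_2,\ldots]$, the convergents $s_k/t_k$ are defined by $s_{-1}=1$, $s_0=a_0$, $s_k=a_ks_{k-1}+s_{k-2}$ and $t_{-1}=0$, $t_0=1$, $t_k=a_kt_{k-1}+t_{k-2}$ for $k\ge1$. For an odd natural number $n$ and an integer $m$ coprime to $n$, $\left(\frac{m}{n}\right)$ is the usual Jacobi symbol (equal to $1$ if $n=1$); if $n$ is even and $\gcd(m,n)=1$, one sets $\left(\frac{m}{n}\right)=*$, a fixed symbol different from $\pm1$. The Jacobi sequence of $x$ is $c_k=\left(\frac{s_k}{t_k}\right)$, $k\ge 0$. It is purely periodic with period length $L\ge1$ if $c_{k+L}=c_k$ for all $k\ge0$; the smallest period length is the least such $L$. *)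

(* Defs.v *)
From HB Require Import structures.
From mathcomp Require Import all_boot all_order all_algebra.
From mathcomp Require Import reals sequences exp.
Set Implicit Arguments. Unset Strict Implicit. Unset Printing Implicit Defensive.
Import Order.TTheory GRing.Theory Num.Theory.
Local Open Scope ring_scope.

Fixpoint cf_state (R : realType) (x : R) (k : nat) : R :=
  match k with
  | 0 => x
  | k'.+1 => (cf_state x k' - (Num.floor (cf_state x k'))%:~R)^-1
  end.

Definition cf_a (R : realType) (x : R) (k : nat) : int := Num.floor (cf_state x k).

(* cf_conv x k = ((s_{k-1}, t_{k-1}), (s_k, t_k)) *)
Fixpoint cf_conv (R : realType) (x : R) (k : nat) : (int * int) * (int * int) :=
  match k with
  | 0 => ((1, 0), (cf_a x 0, 1))
  | k'.+1 =>
      let: ((sp, tp), (s, t)) := cf_conv x k' in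
      ((s, t), (cf_a x k * s + sp, cf_a x k * t + tp))
  end.

Definition cf_s (R : realType) (x : R) (k : nat) : int := (cf_conv x k).2.1.
Definition cf_t (R : realType) (x : R) (k : nat) : int := (cf_conv x k).2.2.

Definition legendre (m : int) (p : nat) : int :=
  if (p%:Z %| m)%Z then 0
  else if [exists y : 'I_p, (p%:Z %| (y%:Z ^+ 2 - m))%Z] then 1 else -1.

(* Jacobi symbol (m / n): Some of the usual value for odd n (product of Legendre
   symbols over the prime factorisation, = 1 for n = 1); None plays the role of
   the symbol '*' for even n. *)
Definition jacobi (m : int) (n : nat) : option int :=
  if odd n then Some (\prod_(p <- primes n) legendre m p ^+ logn p n) else None.

(* The Jacobi sequence c_k = (s_k / t_k); t_k >= 1 for k >= 0 so |t_k| = t_k. *)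
Definition jacobi_seq (R : realType) (x : R) (k : nat) : option int :=
  jacobi (cf_s x k) `|cf_t x k|%N.

Definition purely_periodic_with (T : Type) (c : nat -> T) (L : nat) : Prop :=
  (1 <= L)%N /\ forall k, c (k + L)%N = c k.

Definition smallest_period (T : Type) (c : nat -> T) (L : nat) : Prop :=
  purely_periodic_with c L /\
  forall L', purely_periodic_with c L' -> (L <= L')%N.

(* Main.v *)
Require Import Defs.
From HB Require Import structures.
From mathcomp Require Import all_boot all_order all_algebra.
From mathcomp Require Import fingroup cyclic finfield.
From mathcomp Require Import boolp classical_sets functions reals topology normedtype.
From mathcomp Require Import derive sequences realfun exp.
From mathcomp Require Import zify ring lra.
Import Order.TTheory GRing.Theory Num.Theory.
Import numFieldNormedType.Exports.
Local Open Scope ring_scope.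

(* With z = 1/n, the number is coth z, whose partial quotients are
   a_k = (2k+1)n.  Put h_0 = 2 sinh z, h_1 = 2(z cosh z - sinh z) and
   h_(k+2) = z^2 h_k - (2k+3) h_(k+1).  The k-th complete quotient is
   (2k+1)n + n h_(k+1)/h_k, and it only remains to see that h_k > 0: this holds
   since h_(k+1)' = z h_k and h_k(0) = 0.

   As s_k t_(k-1) - s_(k-1) t_k = (-1)^(k-1), the symbol (s_k/t_k) equals
   ((-1)^(k-1)/t_k) (t_(k-1)/t_k).  By quadratic reciprocity and the
   supplementary laws, passing from (t_(k-1)/t_k) to (t_k/t_(k+1)), where
   t_(k+1) = a_(k+1) t_k + t_(k-1), changes the symbol by a sign which depends
   only on t_(k-1) and t_k mod 8 and on a_(k+1) mod 8; when t_k is even one uses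
   (t_k/t_(k-1)) instead.  So c_k is the output of a finite automaton fed with
   (2k+1)n mod 8, which is back in its initial state after 24 steps, and a finite
   computation for n mod 8 settles the periods. *)

(** * The Legendre symbol and quadratic reciprocity *)

(** The unit group is cyclic of order 2h. For x = g^i, x^h = 1 means that 2h divides ih, so that i
    is even and x a square; conversely y^(2h) = 1 for every unit y. *)
Lemma euler_criterion (F : finFieldType) (x : F) : odd #|F| -> x != 0 ->
  (x ^+ #|F|./2 == 1) = [exists y, y ^+ 2 == x].
Proof.
move=> oddF x0; set h := (#|F|./2)%N.
have hF : #|F|.-1 = h.*2 by rewrite -(odd_double_half #|F|) oddF add1n.
have h0 : (0 < h)%N by rewrite half_gt0 finNzRing_gt1.
have [g gP] : exists g : {unit F}, [set: {unit F}] = <[g]>%g.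
  by apply/cyclicP; apply: field_unit_group_cyclic.
have og : #[g]%g = h.*2 by rewrite /order -gP card_finField_unit hF.
have ux : x \is a GRing.unit by rewrite unitfE.
have [i xE] : exists i, x = val g ^+ i.
  have /cycleP[i gi] : FinRing.Unit ux \in <[g]>%g by rewrite -gP inE.
  by exists i; rewrite -FinRing.val_unitX -gi.
have gX j : (val g ^+ j == 1) = (h.*2 %| j)%N.
  rewrite -og order_dvdn -FinRing.val_unitX.
  by apply/eqP/eqP => [e|->//]; apply: val_inj.
apply/idP/existsP => [|[y /eqP yx]].
  rewrite xE -exprM gX -muln2 mulnC dvdn_pmul2r // => /dvdnP[j ->].
  by exists (val g ^+ j); rewrite -exprM mulnC mulnC.
have y0 : y != 0 by apply: contra_neq x0 => y0; rewrite -yx y0 expr0n.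
rewrite -yx -exprM mul2n -hF -(inj_eq (mulfI y0)) mulr1 -exprS prednK ?expf_card //.
by rewrite (ltn_trans _ (finNzRing_gt1 F)).
Qed.

(* The exponent of the supplementary law (2/n) = (-1)^((n^2-1)/8). *)
Definition chi2 (n : nat) : bool := ((n %% 8 == 3) || (n %% 8 == 5))%N.

Definition is_sign0 (x : int) := (x == 0) || (x == 1) || (x == -1).

Lemma legendre_sign0 m p : is_sign0 (legendre m p).
Proof. by rewrite /legendre; case: ifP => // _; case: ifP. Qed.

Section OddPrime.
Variable p : nat.
Hypotheses (p_pr : prime p) (p_odd : odd p).
Local Notation h := (p./2).

Let pC : p \in [pchar 'F_p] := pchar_Fp p_pr.

Let p_h : p = h.*2.+1.
Proof. by rewrite -[LHS](odd_double_half p) p_odd. Qed.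

Let h_gt0 : (0 < h)%N.
Proof. by have := prime_gt1 p_pr; lia. Qed.

Lemma Fp_int_eq0 (m : int) : (m%:~R == 0 :> 'F_p) = (p%:Z %| m)%Z.
Proof. by rewrite -(dvdz_pcharf pC). Qed.

Lemma Fp_nat_eq0 (m : nat) : (m%:R == 0 :> 'F_p) = (p %| m)%N.
Proof. by rewrite -(dvdn_pcharf pC). Qed.

(** Two elements of {0, 1, -1} differ by at most 2 < p. Hence identities between symbols can be
    proved in ['F_p], where [legendreE] turns them into powers. *)
Lemma sign0_Fp_inj x y : is_sign0 x -> is_sign0 y ->
  x%:~R = y%:~R :> 'F_p -> x = y.
Proof.
move=> hx hy /eqP; rewrite -subr_eq0 -rmorphB Fp_int_eq0 /dvdz /=.
move: p_h h_gt0 hx hy; rewrite /is_sign0 => ph h0.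
case/orP => [/orP[]|] /eqP -> /orP[/orP[]|] /eqP -> //= => /dvdn_leq; lia.
Qed.

Lemma Fp_intE (m : int) : exists i : nat, (i < p)%N && (i%:~R == m%:~R :> 'F_p).
Proof.
exists `|(m %% p)%Z|%N.
have p0 : (p%:Z != 0) by have := p_h; lia.
have h1 := modz_ge0 m p0.
have h2 : ((m %% p)%Z < p%:Z) by rewrite ltz_pmod //; have := p_h; lia.
apply/andP; split; first by lia.
rewrite gez0_abs // -subr_eq0 -rmorphB Fp_int_eq0 -eqz_mod_dvd.
by rewrite modz_mod.
Qed.

Lemma legendreE (m : int) : (legendre m p)%:~R = m%:~R ^+ h :> 'F_p.
Proof.
rewrite /legendre -Fp_int_eq0.
have [->|m0] := eqVneq; first by rewrite expr0n -[h]prednK.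
have card_odd : odd #|'F_p| by rewrite card_Fp.
have := @euler_criterion 'F_p _ card_odd m0; rewrite card_Fp // => E.
have -> : [exists y : 'I_p, (p%:Z %| y%:Z ^+ 2 - m)%Z] =
          [exists y : 'F_p, y ^+ 2 == m%:~R].
  apply/existsP/existsP => [[y]|[y /eqP yE]].
    rewrite -Fp_int_eq0 rmorphB subr_eq0 rmorphXn /= => yE.
    by exists (y%:R).
  have [i /andP[ip /eqP iE]] := Fp_intE (y : nat).
  exists (Ordinal ip); rewrite -Fp_int_eq0 rmorphB subr_eq0 rmorphXn /=.
  by rewrite iE -yE -[in eqbRHS](natr_Zp y).
rewrite -E; case: eqP => [->//|/eqP n1].
(* The square of m^h is m^(p-1) = 1, so a non-square m has m^h = -1. *)
have : (m%:~R ^+ h - 1) * (m%:~R ^+ h + 1) == 0 :> 'F_p.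
  rewrite -subr_sqr expr1n subr_eq0 -exprM muln2.
  rewrite -(inj_eq (mulfI m0)) mulr1 -exprS -p_h.
  by have := expf_card (m%:~R : 'F_p); rewrite card_Fp // => ->.
by rewrite mulf_eq0 subr_eq0 (negPf n1) /= addr_eq0 => /eqP ->.
Qed.

Lemma legendreM m1 m2 : legendre (m1 * m2) p = legendre m1 p * legendre m2 p.
Proof.
apply: sign0_Fp_inj; first exact: legendre_sign0.
  have:= (legendre_sign0 m1 p, legendre_sign0 m2 p); rewrite /is_sign0.
  by case=> /orP[/orP[]|] /eqP -> /orP[/orP[]|] /eqP ->.
by rewrite rmorphM /= !legendreE rmorphM exprMn.
Qed.

Lemma legendre_mod m1 m2 : (p %| m1 - m2)%Z -> legendre m1 p = legendre m2 p.
Proof.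
rewrite -Fp_int_eq0 rmorphB subr_eq0 => /eqP e.
by apply: sign0_Fp_inj; rewrite ?legendre_sign0 ?legendreE ?e.
Qed.

Lemma sign0_signr (b : bool) : is_sign0 ((-1) ^+ b).
Proof. by case: b. Qed.

Lemma legendreN1 : legendre (-1) p = (-1) ^+ odd h.
Proof.
apply: sign0_Fp_inj; rewrite ?legendre_sign0 ?sign0_signr //.
by rewrite legendreE signr_odd rmorphXn.
Qed.

(** * Gauss's lemma and its form with floor sums *)

Section Gauss.
Variable a : nat.
Hypothesis (pa : ~~ (p %| a)%N).

(** [r j] is the absolute value of the residue of a j lying between -h and h, and [mu j] tells
    whether that residue is negative. *)
Let mu j := (h < a * j %% p)%N.
Let r j := if mu j then (p - a * j %% p)%N else (a * j %% p)%N.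

Let r_Fp j : (r j)%:R = (-1) ^+ mu j * (a * j)%:R :> 'F_p.
Proof.
have mp : (a * j %% p)%:R = (a * j)%:R :> 'F_p.
  by rewrite -[in LHS]Fp_nat_mod // modn_mod Fp_nat_mod.
rewrite /r; case: ifP => _; rewrite ?mul1r // mulN1r natrB ?mp.
  by rewrite pchar_Fp_0 // sub0r.
by rewrite ltnW // ltn_mod prime_gt0.
Qed.

(** Squaring removes the signs: (a i)^2 = (a j)^2 in ['F_p] forces i = j or i = -j, and 0 < i + j <=
    2h < p excludes the latter. *)
Let r_inj : {in index_iota 1 h.+1 &, injective r}.
Proof.
move=> i j; rewrite !mem_index_iota.
move=> /andP[i1 ih] /andP[j1 jh] /(congr1 (fun n => n%:R ^+ 2 : 'F_p)).
rewrite !r_Fp !exprMn !sqrr_sign !mul1r !natrM => /eqP.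
rewrite -subr_eq0 subr_sqr -mulrDr -mulrBr !mulf_eq0 Fp_nat_eq0 (negPf pa) /=.
have Hle u v : (u <= v)%N -> (v < h.+1)%N -> ((v - u)%:R == 0 :> 'F_p) -> u = v.
  move=> uv vh; rewrite Fp_nat_eq0.
  by have [H /(dvdn_leq H)|/negP] := ltnP 0 (v - u); have := p_h; lia.
rewrite -natrD Fp_nat_eq0 => /orP[|]; last first.
  by have [H /(dvdn_leq H)|] := ltnP 0 (i + j); have := p_h; lia.
have [ij|/ltnW ij] := leqP i j; last by rewrite -natrB // => H; rewrite -(Hle j i).
by rewrite -opprB oppr_eq0 -natrB // => H; rewrite (Hle i j).
Qed.

Let r_range : {subset [seq r j | j <- index_iota 1 h.+1] <= index_iota 1 h.+1}.
Proof.
move=> _ /mapP[j + ->]; rewrite !mem_index_iota /r /mu => /andP[j1 jh].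
have : (0 < a * j %% p)%N.
  rewrite lt0n -/(dvdn p (a * j)) Euclid_dvdM // negb_or pa /=.
  by apply/negP => /dvdn_leq; have := p_h; lia.
have : (a * j %% p < p)%N by rewrite ltn_mod prime_gt0.
by have := p_h; case: ifP; lia.
Qed.

Lemma gauss_perm :
  perm_eq [seq r j | j <- index_iota 1 h.+1] (index_iota 1 h.+1).
Proof.
have uniq_r : uniq [seq r j | j <- index_iota 1 h.+1].
  by rewrite map_inj_in_uniq ?iota_uniq.
have [|_ eq_r] := uniq_min_size uniq_r r_range; first by rewrite size_map.
by apply: uniq_perm; rewrite ?iota_uniq.
Qed.

Lemma gauss_big (T : Type) (idx : T) (op : Monoid.com_law idx) (F : nat -> T) :
  \big[op/idx]_(1 <= j < h.+1) F (r j) = \big[op/idx]_(1 <= j < h.+1) F j.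
Proof. by rewrite -[RHS](perm_big _ gauss_perm) big_map. Qed.

(** Multiply [r_Fp] over all j: since [r] permutes 1, ..., h, the factor h! cancels and a^h times
    the product of the signs is 1. *)
Lemma gauss_lemma :
  legendre a p = (-1) ^+ odd (\sum_(1 <= j < h.+1) (h < a * j %% p)).
Proof.
apply: sign0_Fp_inj; rewrite ?legendre_sign0 ?sign0_signr //.
rewrite legendreE signr_odd rmorphXn rmorphN1 -pmulrn.
have e : \prod_(1 <= j < h.+1) (r j)%:R = \prod_(1 <= j < h.+1) j%:R :> 'F_p.
  exact: (@gauss_big 'F_p 1 *%R (fun n => n%:R)).
have nz : \prod_(1 <= j < h.+1) j%:R != 0 :> 'F_p.
  rewrite prodf_seq_neq0; apply/allP => j; rewrite mem_index_iota /= Fp_nat_eq0.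
  by move=> /andP[j1 jh]; apply/negP => /dvdn_leq; have := p_h; lia.
set P := (X in X != 0) in nz; move: e; rewrite -/P.
under eq_bigr do rewrite r_Fp natrM.
rewrite !big_split /= -/P -[RHS]mul1r mulrA => /(mulIf nz).
rewrite big_const_nat iter_mulr_1 subn1 /= -expr_sum => e.
by rewrite -[LHS](signrMK (\sum_(1 <= j < h.+1) mu j)) e mulr1.
Qed.

(* As p is odd, a j = p floor(a j / p) + (a j mod p) reads
   a j = floor(a j / p) + r j + mu j mod 2; sum over j, r being a permutation. *)
Lemma eisenstein : odd (\sum_(1 <= j < h.+1) (h < a * j %% p)) =
  odd (\sum_(1 <= j < h.+1) (a * j %/ p) + a.+1 * \sum_(1 <= j < h.+1) j).
Proof.
have e : (\sum_(1 <= j < h.+1) r j = \sum_(1 <= j < h.+1) j)%N.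
  exact: gauss_big.
set X := (X in odd X = _); set Y := (Y in _ = odd Y).
suff : odd (X + Y) = false by rewrite oddD; case: (odd X); case: (odd Y).
rewrite /X /Y mulSn -{1}e big_distrr -!big_split /=.
apply: (big_ind (fun x => odd x = false)) => // [x y hx hy|j _].
  by rewrite oddD hx hy.
have := ltn_mod (a * j) p; rewrite prime_gt0 // => lt_mod.
have := divn_eq (a * j) p; rewrite /r /mu; move: lt_mod => /idP.
move: (_ %% _)%N (_ %/ _)%N => x y lt_x ->.
have : odd (y * p) = odd y by rewrite oddM p_odd andbT.
by have := p_h; case: ifP; lia.
Qed.

End Gauss.

Lemma legendre_odd (q : nat) : odd q -> ~~ (p %| q)%N ->
  legendre q p = (-1) ^+ odd (\sum_(1 <= j < h.+1) (q * j %/ p)).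
Proof.
by move=> qo pq; rewrite gauss_lemma // eisenstein // oddD oddM /= qo addbF.
Qed.

(** For a = 2 all floors vanish, as 2j <= 2h < p. What remains is 3 h(h+1)/2, with the parity of
    h(h+1)/2 = (p^2-1)/8. *)
Lemma legendre2 : legendre 2 p = (-1) ^+ chi2 p.
Proof.
have p2 : ~~ (p %| 2)%N by apply/negP => /dvdn_leq; have := p_h; lia.
rewrite (gauss_lemma _ p2) eisenstein // big1_seq ?add0n => [|j].
  rewrite oddM /= /chi2; congr (_ ^+ nat_of_bool _).
  have tri k : (\sum_(1 <= j < k.+1) j).*2 = (k * k.+1)%N.
    elim: k => [|k IH]; first by rewrite big_geq.
    by rewrite big_nat_recr //= doubleD IH; lia.
  by have := tri h; have := p_h; nia.
by rewrite mem_index_iota => /andP[_ /andP[_ jh]]; apply: divn_small; have := p_h; lia.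
Qed.

End OddPrime.

(** The two sums count the lattice points (j, i) of a rectangle on either side of the line p i = q
    j. No point lies on it, since p would divide j < p. *)
Lemma lattice_count p q : odd p -> odd q -> coprime p q ->
  (\sum_(1 <= j < p./2.+1) (q * j %/ p) + \sum_(1 <= i < q./2.+1) (p * i %/ q) =
   p./2 * q./2)%N.
Proof.
have count_le m k : (m <= k)%N -> (\sum_(1 <= i < k.+1) (i <= m) = m)%N.
  move=> mk; rewrite (big_cat_nat _ (n := m.+1)) //=.
  rewrite (eq_big_nat _ _ (F2 := fun=> 1%N)) => [|i /andP[_]]; last by rewrite ltnS => ->.
  rewrite sum_nat_const_nat (eq_big_nat _ _ (F2 := fun=> 0%N)) => [|i /andP[mi _]].
    by rewrite sum_nat_const_nat; lia.
  by rewrite leqNgt mi.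
have row p' q' : odd p' -> odd q' -> (\sum_(1 <= j < p'./2.+1) (q' * j %/ p') =
    \sum_(1 <= j < p'./2.+1) \sum_(1 <= i < q'./2.+1) (p' * i <= q' * j))%N.
  move=> op oq; apply: eq_big_nat => j /andP[j1 jh].
  have p0 : (0 < p')%N by lia.
  rewrite -[LHS](count_le _ q'./2); last first.
    by rewrite -ltnS ltn_divLR //; nia.
  by apply: eq_bigr => i _; rewrite leq_divRL // [(i * _)%N]mulnC.
move=> op oq cpq; rewrite (row p q) // (row q p) // [X in (_ + X)%N]exchange_big -big_split /=.
under eq_bigr do rewrite -big_split /=.
rewrite (eq_big_nat _ _ (F2 := fun=> q./2)) => [|j /andP[j1 jh]].
  by rewrite sum_nat_const_nat; lia.
rewrite (eq_big_nat _ _ (F2 := fun=> 1%N)) => [|i /andP[i1 ih]].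
  by rewrite sum_nat_const_nat; lia.
have : (p * i != q * j)%N; last by lia.
apply/negP => /eqP e; have : (p %| j)%N by rewrite -(Gauss_dvdr _ cpq) -e dvdn_mulr.
by move/dvdn_leq; lia.
Qed.

Lemma quadratic_reciprocity p q : prime p -> prime q -> odd p -> odd q -> p != q ->
  legendre q p * legendre p q = (-1) ^+ (odd p./2 && odd q./2).
Proof.
move=> pp qp op oq npq.
have pq : ~~ (p %| q)%N by rewrite dvdn_prime2.
have qp' : ~~ (q %| p)%N by rewrite dvdn_prime2 // eq_sym.
rewrite !legendre_odd // -signr_addb -oddD lattice_count ?oddM //.
by rewrite prime_coprime.
Qed.

(** * The Jacobi symbol *)

Definition jac (m : int) (n : nat) : int :=
  \prod_(p <- primes n) legendre m p ^+ logn p n.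

(** A range of factors that is the same for several n allows their products to be merged factor by
    factor. *)
Lemma jacE m n B : (0 < n)%N -> (n < B)%N ->
  jac m n = \prod_(0 <= p < B) legendre m p ^+ logn p n.
Proof.
move=> n0 nB; rewrite (bigID (mem (primes n))) /= [X in _ * X]big1 ?mulr1 => [|p].
  rewrite /jac -[RHS]big_filter; apply: perm_big; apply: uniq_perm.
  - exact: primes_uniq.
  - by rewrite filter_uniq // iota_uniq.
  move=> p; rewrite mem_filter mem_index_iota /= andbC.
  case: (boolP (p \in primes n)) => [|_]; last by rewrite andbF.
  by rewrite mem_primes andbT => /and3P[_ _ /(dvdn_leq n0) pn]; rewrite (leq_ltn_trans pn).
by rewrite -logn_gt0 lt0n negbK => /eqP ->.
Qed.

Lemma jac1 m : jac m 1 = 1.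
Proof. by rewrite /jac big_nil. Qed.

Lemma jac_prime m p : prime p -> jac m p = legendre m p.
Proof. by move=> pp; rewrite /jac primes_prime // big_seq1 logn_prime // eqxx. Qed.

Lemma jacMr m n1 n2 : (0 < n1)%N -> (0 < n2)%N ->
  jac m (n1 * n2) = jac m n1 * jac m n2.
Proof.
move=> n10 n20; have n0 : (0 < n1 * n2)%N by rewrite muln_gt0 n10.
rewrite !(jacE _ _ (n1 * n2).+1) ?ltnS ?leq_pmulr ?leq_pmull // -big_split /=.
by apply: eq_bigr => p _; rewrite lognM // exprD.
Qed.

(** This induction reduces laws of the Jacobi symbol to the Legendre symbol. *)
Lemma odd_mul_ind (P : nat -> Prop) : P 1%N ->
  (forall p, prime p -> odd p -> P p) ->
  (forall a b, odd a -> odd b -> P a -> P b -> P (a * b)%N) ->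
  forall n, odd n -> P n.
Proof.
move=> P1 Pp PM; elim/ltn_ind => n IH on.
have [n1|n1] := leqP n 1; first by have -> : n = 1%N by lia.
have pp := pdiv_prime n1; have /dvdnP[m nE] := pdiv_dvd n.
move: on; rewrite nE oddM => /andP[om op].
apply: PM => //; last exact: Pp.
by apply: IH => //; have := prime_gt1 pp; nia.
Qed.

Lemma jacMl m1 m2 n : odd n -> jac (m1 * m2) n = jac m1 n * jac m2 n.
Proof.
move: n; apply: odd_mul_ind => [|p pp op|a b oa ob Ha Hb]; first by rewrite !jac1.
  by rewrite !jac_prime // legendreM.
by rewrite !jacMr ?odd_gt0 // Ha Hb; ring.
Qed.

Lemma jac_mod m1 m2 n : odd n -> (n %| m1 - m2)%Z -> jac m1 n = jac m2 n.
Proof.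
move=> on; elim/odd_mul_ind: n / on => [|p pp op|a b oa ob Ha Hb]; first by rewrite !jac1.
  by rewrite !jac_prime //; apply: legendre_mod.
rewrite PoszM => d; rewrite !jacMr ?odd_gt0 // Ha ?Hb //.
  by apply: dvdz_trans d; rewrite dvdz_mull.
by apply: dvdz_trans d; rewrite dvdz_mulr.
Qed.

Lemma jac_sqr m n : odd n -> coprimez m n -> jac m n ^+ 2 = 1.
Proof.
move=> on; elim/odd_mul_ind: n / on => [|p pp op|a b oa ob Ha Hb]; first by rewrite !jac1.
  rewrite jac_prime // /legendre coprimez_sym /coprimez => c.
  case: ifP => [pm|_]; last by case: ifP.
  by move: c; rewrite (gcdz_idPl pm) //=; have := prime_gt1 pp; lia.
rewrite PoszM coprimezMr => /andP[ca cb].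
by rewrite !jacMr ?odd_gt0 // exprMn Ha ?Hb.
Qed.

Lemma jac_one n : odd n -> jac 1 n = 1.
Proof.
move=> on; rewrite -[1 in LHS](mulr1 1) jacMl // -expr2 jac_sqr //.
by rewrite /coprimez gcd1z.
Qed.

(** For odd a, [odd a./2] means a = 3 mod 4; this is the multiplicativity of (-1)^((a-1)/2). *)
Lemma odd_halfM a b : odd a -> odd b -> odd (a * b)./2 = odd a./2 (+) odd b./2.
Proof.
move=> oa ob; have -> : ((a * b)./2 = (a./2 * b./2).*2 + a./2 + b./2)%N.
  have := odd_double_half a; have := odd_double_half b; rewrite oa ob /=.
  by move: (a./2) (b./2) => x y <- <-; nia.
by rewrite !oddD odd_double.
Qed.

Lemma jacN1 n : odd n -> jac (-1) n = (-1) ^+ odd n./2.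
Proof.
move: n; apply: odd_mul_ind => [|p pp op|a b oa ob Ha Hb]; first by rewrite jac1.
  by rewrite jac_prime // legendreN1.
rewrite jacMr ?odd_gt0 // Ha Hb -signr_addb; congr (_ ^+ nat_of_bool _).
exact/esym/odd_halfM.
Qed.

Lemma jac2 n : odd n -> jac 2 n = (-1) ^+ chi2 n.
Proof.
move: n; apply: odd_mul_ind => [|p pp op|a b oa ob Ha Hb]; first by rewrite jac1.
  by rewrite jac_prime // legendre2.
rewrite jacMr ?odd_gt0 // Ha Hb -signr_addb; congr (_ ^+ nat_of_bool _).
rewrite /chi2 -modnMm.
(* [chi2] is additive on products of odd numbers: sixteen pairs of residues mod 8. *)
have odd8 c : odd c -> (c %% 8 \in [:: 1; 3; 5; 7])%N by rewrite !inE; lia.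
move: (odd8 _ oa) (odd8 _ ob); rewrite !inE.
by do 2![case/or4P=> /eqP ->].
Qed.

Lemma jac_reciprocity m n : odd m -> odd n -> coprime m n ->
  jac m n * jac n m = (-1) ^+ (odd m./2 && odd n./2).
Proof.
have S (x y : int) (b1 b2 : bool) : x = (-1) ^+ b1 -> y = (-1) ^+ b2 -> x * y = (-1) ^+ (b1 (+) b2).
  by move=> -> ->; rewrite signr_addb.
move=> om on; elim/odd_mul_ind: n / on m om => [|q pq oq|a b oa ob Ha Hb] m om.
- by rewrite jac1 mul1r jac_one // andbF.
- elim/odd_mul_ind: m / om => [|p pp op|a b oa ob Ha Hb].
  + by rewrite jac1 mulr1 jac_one.
  + rewrite prime_coprime // dvdn_prime2 // => npq.
    by rewrite !jac_prime // mulrC quadratic_reciprocity.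
  + rewrite coprimeMl => /andP[ca cb]; rewrite PoszM jacMl // jacMr ?odd_gt0 //.
    by rewrite mulrACA (S _ _ _ _ (Ha ca) (Hb cb)) odd_halfM // andb_addl.
- rewrite coprimeMr => /andP[ca cb]; rewrite PoszM jacMl // jacMr ?odd_gt0 //.
  by rewrite mulrACA (S _ _ _ _ (Ha _ om ca) (Hb _ om cb)) odd_halfM // andb_addr.
Qed.

Lemma jac_swap m n : odd m -> odd n -> coprime m n ->
  jac m n = (-1) ^+ (odd m./2 && odd n./2) * jac n m.
Proof.
move=> om on mn; rewrite -jac_reciprocity // -mulrA -expr2.
by rewrite jac_sqr ?mulr1 // /coprimez /gcdz /= gcdnC.
Qed.

Lemma jac2X e n : odd n -> jac (2 ^ e)%N n = (-1) ^+ (odd e && chi2 n).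
Proof.
move=> on; elim: e => [|e IH].
  by rewrite jac_one.
rewrite expnS PoszM jacMl // IH jac2 // -signr_addb; congr (_ ^+ nat_of_bool _).
by rewrite /=; case: (odd e) (chi2 n) => [] [].
Qed.

(* The Jacobi symbol of a coprime pair: when q is even, p is odd and goes below. *)
Definition jsym (p q : nat) : int := if odd q then jac p q else jac q p.

(** The exponent of the sign between (p/q) and (q/q') when q' = p mod q. For q = 2m with m odd, the
    terms [chi2] come from the factor 2, and the last one from swapping m with p and q', where m = 3
    mod 4 exactly if q = 6 mod 8. *)
Definition jstep (p q q' : nat) : bool :=
  if odd q then odd q' && (odd q./2 && odd q'./2)
  else if (q %% 4 == 0)%N then false
  else (chi2 p (+) chi2 q') (+) ((q %% 8 == 6)%N && (odd p./2 (+) odd q'./2)).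

(** For q odd, (q'/q) = (p/q), followed by reciprocity if q' is odd. For q = 2^e m with m odd, (q/p)
    and (q/q') are compared by splitting off 2^e and swapping m, because (p/m) = (q'/m). *)
Lemma jsym_step p q a : (0 < q)%N -> coprime p q ->
  jsym q (a * q + p) = (-1) ^+ jstep p q (a * q + p) * jsym p q.
Proof.
move=> q0 pq; set q' := (a * q + p)%N.
have qq' : coprime q q' by rewrite /q' /coprime gcdnMDl gcdnC.
have modq m : (m %| q)%N -> (m %| q'%:Z - p%:Z)%Z.
  by move=> mq; rewrite /q' PoszD addrK dvdzE !absz_nat dvdn_mull.
rewrite /jsym /jstep; case: (boolP (odd q)) => oq /=.
  case: (boolP (odd q')) => oq' /=; last by rewrite mul1r; apply: jac_mod => //; apply: modq.
  by rewrite jac_swap //; congr (_ * _); apply: jac_mod => //; apply: modq.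
have op : odd p.
  apply/negPn/negP => /negPf ep; move: pq; rewrite /coprime => /eqP g.
  by have : (2 %| gcdn p q)%N; [rewrite dvdn_gcd !dvdn2 ep oq | rewrite g].
have oq' : odd q' by rewrite /q' oddD oddM (negPf oq) andbF op.
rewrite oq'.
have [m om qE] := pfactor_coprime (isT : prime 2) q0.
move: om qE; rewrite coprime2n; move: (logn 2 q) => e om; rewrite mulnC => qE.
have mp : coprime m p by move: pq; rewrite coprime_sym qE coprimeMl => /andP[].
have mq' : coprime m q' by move: qq'; rewrite qE coprimeMl => /andP[].
rewrite qE PoszM !jacMl // !jac2X // -qE.
rewrite (jac_swap _ _ om oq') // (jac_swap _ _ om op) //.
rewrite (jac_mod _ p%:Z m om) ?modq ?qE ?dvdn_mull // -qE.
rewrite !mulrA -!signr_addb; congr (_ ^+ nat_of_bool _ * _).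
have mod8 r b : (8 %| r)%N -> chi2 (r + b) = chi2 b.
  by move=> /eqP r0; rewrite /chi2 -(modnDml r) r0.
have mod4 r b : (4 %| r)%N -> odd (r + b)./2 = odd b./2.
  by move=> /dvdnP[c ->]; lia.
(* e = 0 contradicts the parity of q, and e = 1 gives the signs of [jstep]. For e >= 2 all signs
   cancel: p = q' mod 4, and either e = 2 is even or p = q' mod 8. *)
case: e qE => [|[|e]] qE /=; first by move: oq; rewrite qE mul1n om.
  have [-> ->] : ((q %% 4 == 0) = false /\ (q %% 8 == 6) = odd m./2)%N.
    by move: om; rewrite qE; lia.
  by case: (chi2 q') (chi2 p) (odd m./2) (odd q'./2) (odd p./2) => [] [] [] [] [].
have d4 : (4 %| q)%N by rewrite qE 2!expnS mulnA -mulnA dvdn_mulr.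
rewrite -/(dvdn 4 q) d4 /q' mod4 ?dvdn_mull //.
case: e qE => [|e] qE //; rewrite mod8 // dvdn_mull //.
by rewrite qE 3!expnS !mulnA -!mulnA 2!mulnA dvdn_mulr.
Qed.

(** * The continued fraction of coth(1/n) *)

Section Coth.
Variable R : realType.
Implicit Types (z : R) (k : nat).

Definition sh2 z : R := expR z - expR (- z).
Definition ch2 z : R := expR z + expR (- z).

(* h_k(z) = 2 z^(k+1) i_k(z), where i_k is the modified spherical Bessel
   function of the first kind. *)
Fixpoint bessel_h (k : nat) (z : R) : R :=
  match k with
  | 0 => sh2 z
  | k1.+1 => match k1 with
    | 0 => z * ch2 z - sh2 z
    | k2.+1 => z ^+ 2 * bessel_h k2 z - (k2.*2 + 3)%:R * bessel_h k1 z
    end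
  end.

Lemma bessel_hSS k z :
  bessel_h k.+2 z = z ^+ 2 * bessel_h k z - (k.*2 + 3)%:R * bessel_h k.+1 z.
Proof. by []. Qed.

Lemma is_derive_sh2 z : is_derive z 1 sh2 (ch2 z).
Proof.
rewrite /sh2 /ch2.
have d : is_derive z 1 (fun z => expR (- z)) (- expR (- z)).
  rewrite -mulN1r mulrC; apply: (@is_derive1_comp R expR -%R z).
by apply: is_derive_eq; rewrite opprK.
Qed.

Lemma is_derive_ch2 z : is_derive z 1 ch2 (sh2 z).
Proof.
rewrite /sh2 /ch2.
have d : is_derive z 1 (fun z => expR (- z)) (- expR (- z)).
  rewrite -mulN1r mulrC; apply: (@is_derive1_comp R expR -%R z).
by apply: is_derive_eq.
Qed.

Lemma is_derive_bessel k z :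
  is_derive z 1 (bessel_h k) (if k is k'.+1 then z * bessel_h k' z else ch2 z).
Proof.
have did (u : R) : is_derive u 1 id (1 : R) by exact: is_derive_id.
have dsh := is_derive_sh2; have dch := is_derive_ch2.
have d1 (u : R) : is_derive u 1 (bessel_h 1) (u * bessel_h 0 u).
  have -> : bessel_h 1 = id * ch2 - sh2 by apply/funext.
  by apply: is_derive_eq; rewrite /GRing.scale /= /GRing.mul_fun; ring.
case: k => [|k]; first exact: dsh.
(* The recurrence reaches two indices back, so the induction carries two consecutive derivatives. *)
suff [] : is_derive z 1 (bessel_h k.+1) (z * bessel_h k z) /\
  is_derive z 1 (bessel_h k.+2) (z * bessel_h k.+1 z) by [].
have step (f g : R -> R) (c df : R) : is_derive z 1 f df ->
    is_derive z 1 g (z * f z) ->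
    is_derive z 1 (fun u => u ^+ 2 * f u - c * g u)
      (2 * z * f z + z ^+ 2 * df - c * (z * f z)).
  move=> dF dG; have -> : (fun u => u ^+ 2 * f u - c * g u) =
    id ^+ 2 * f - cst c * g by apply/funext.
  apply: is_derive_eq; rewrite /GRing.scale /= /cst.
  by have -> : (id ^+ 2 : R -> R) z = z ^+ 2 by []; ring.
elim: k => [|k [IH1 IH2]].
  split=> //; apply: (is_derive_eq (step _ _ _ _ (dsh z) (d1 z))).
  by rewrite /= -[(0.*2 + 3)%N]/3%N; ring.
split=> //; apply: (is_derive_eq (step _ _ _ _ IH1 IH2)).
by rewrite /= doubleS -addn2 natrD; ring.
Qed.

Lemma bessel0 k : bessel_h k 0 = 0.
Proof.
have [] : bessel_h k 0 = 0 /\ bessel_h k.+1 0 = 0; last by [].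
elim: k => [|k [h1 h2]]; first by rewrite /= /sh2 oppr0 subrr mul0r subr0.
by split=> //; rewrite bessel_hSS h1 h2 !mulr0 subrr.
Qed.

Lemma bessel_gt0 k z : 0 < z -> 0 < bessel_h k z.
Proof.
elim: k z => [|k IH] z z0; first by rewrite /= /sh2 subr_gt0 ltr_expR; lra.
have d u := is_derive_bessel k.+1 u.
rewrite -(bessel0 k.+1); apply: (@gtr0_derive1_lt_cc _ _ 0 z) => //.
- move=> u; rewrite in_itv /= => /andP[u0 _].
  by rewrite derive1E; have [_ ->] := d u; rewrite mulr_gt0 ?IH.
- apply: continuous_subspaceT => u; apply: differentiable_continuous.
  by apply/derivable1_diffP; case: (d u).
- by rewrite in_itv /= lexx ltW.
- by rewrite in_itv /= lexx ltW.
Qed.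

Lemma cf_state_coth n k : (0 < n)%N ->
  let z := n%:R^-1 : R in
  cf_state ((expR (2 / n%:R) + 1) / (expR (2 / n%:R) - 1)) k =
  (k.*2.+1 * n)%:R + n%:R * (bessel_h k.+1 z / bessel_h k z) /\
  cf_a ((expR (2 / n%:R) + 1) / (expR (2 / n%:R) - 1) : R) k = (k.*2.+1 * n)%:Z.
Proof.
move=> n0 z; set x := (X in cf_state X).
have nR0 : 0 < n%:R :> R by rewrite ltr0n.
have z0 : 0 < z by rewrite invr_gt0.
have h0 j := bessel_gt0 j _ z0.
have hn0 j : bessel_h j z != 0 by rewrite gt_eqF.
have recS j : z * bessel_h j z =
    n%:R * (bessel_h j.+2 z + (j.*2 + 3)%:R * bessel_h j.+1 z).
  by rewrite bessel_hSS subrK mulrA expr2 mulrA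
    divff ?mul1r ?gt_eqF.
(* By [recS] and positivity, z h_j >= (2j+3) h_(j+1) > h_(j+1), where z = 1/n. So this term is the
   fractional part of the complete quotient. *)
have lt1 j : n%:R * (bessel_h j.+1 z / bessel_h j z) < 1.
  rewrite mulrA ltr_pdivrMr // mul1r -ltr_pdivlMl // -/z recS.
  have n1 : 1 <= n%:R :> R by rewrite ler1n.
  have c1 : 1 < (j.*2 + 3)%:R :> R by rewrite ltr1n; lia.
  apply: (@lt_le_trans _ _ ((j.*2 + 3)%:R * bessel_h j.+1 z)).
    by rewrite ltr_pMl.
  apply: (@le_trans _ _ (bessel_h j.+2 z + (j.*2 + 3)%:R * bessel_h j.+1 z)).
    by rewrite lerDr ltW.
  by apply: ler_peMl => //; rewrite addr_ge0 ?mulr_ge0 ?ler0n // ltW.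
have floorE j : cf_state x j = (j.*2.+1 * n)%:R + n%:R * (bessel_h j.+1 z / bessel_h j z) ->
    cf_a x j = (j.*2.+1 * n)%:Z.
  rewrite /cf_a => ->; apply: floor_def; rewrite intrD -pmulrn lerDl ltrD2l lt1 andbT.
  by rewrite mulr_ge0 ?divr_ge0 ?ltW.
suff H : cf_state x k = (k.*2.+1 * n)%:R + n%:R * (bessel_h k.+1 z / bessel_h k z).
  by split=> //; apply: floorE.
elim: k => [|k IH].
  rewrite [cf_state x 0]/= mul1n [bessel_h 1 z]/= [bessel_h 0 z]/=.
  have := hn0 0%N; rewrite [bessel_h 0 z]/= => sh0.
  have xE : x = ch2 z / sh2 z.
    have e : expR (2 / n%:R) = expR z / expR (- z).
      by rewrite -expRN -expRD opprK -/z; congr expR; ring.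
    rewrite /x e; move: sh0; rewrite /sh2 /ch2 => sh0.
    field.
    by rewrite sh0 /= gt_eqF // expR_gt0.
  rewrite xE -{1}[z]invrK invrK; move: sh0; have zn : z != 0 by rewrite gt_eqF.
  have -> : n%:R = z^-1 :> R by rewrite invrK.
  by move=> sh0; field; rewrite ?zn ?sh0.
(* The inverse of the fractional part is z h_k / h_(k+1), which [recS] expands into the next
   complete quotient. *)
rewrite [LHS]/= -/(cf_a x k) (floorE _ IH) IH.
rewrite [_%:~R]/= addrC addKr invfM invf_div -/z [LHS]mulrA recS.
have -> : (k.+1.*2.+1 = k.*2 + 3)%N by lia.
by have := hn0 k.+1 => h1; rewrite natrM; field.
Qed.

End Coth.

(** * The Jacobi sequence as a finite automaton *)

(* The value ((p, q), b) encodes p = t_(k-1) mod 8, q = t_k mod 8 and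
   jsym t_(k-1) t_k = (-1)^b. *)
Fixpoint coth_state (n k : nat) : nat * nat * bool :=
  if k is k'.+1 then
    let: (p, q, b) := coth_state n k' in
    let q' := ((k.*2.+1 * n * q + p) %% 8)%N in (q, q', jstep p q q' (+) b)
  else (0, 1, false)%N.

(** The term added to b is the exponent of ((-1)^(k-1)/t_k), which is trivial for odd k. *)
Definition coth_out (n k : nat) : option bool :=
  let: (p, q, b) := coth_state n k in
  if odd q then Some (b (+) (~~ odd k && odd q./2)) else None.

Lemma jstep_mod8 p q q' : jstep (p %% 8) (q %% 8) (q' %% 8) = jstep p q q'.
Proof.
have h r : (odd (r %% 8) = odd r) * (odd (r %% 8)./2 = odd r./2) *
  (chi2 (r %% 8) = chi2 r) * (r %% 8 %% 4 = r %% 4)%N.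
  by rewrite /chi2 modn_mod; do !split; lia.
by rewrite /jstep !h modn_mod.
Qed.

Lemma det_coprime (s sp : int) (tp t : nat) (b : bool) :
  s * tp%:Z - sp * t%:Z = (-1) ^+ b -> coprimez tp t.
Proof.
move=> D; apply/coprimezP; exists ((-1) ^+ b * s, - ((-1) ^+ b * sp)).
by rewrite /= mulNr -!mulrA -mulrBr D -expr2 sqrr_sign.
Qed.

(** * The automaton follows the convergents *)

Section Convergents.
Variables (R : realType) (x : R) (n : nat).
Hypothesis n_gt0 : (0 < n)%N.
Hypothesis cf_ax : forall k, cf_a x k = (k.*2.+1 * n)%:Z.

Lemma cf_conv_state k : exists sp tp s t : nat, exists b : bool,
  [/\ cf_conv x k = ((sp%:Z, tp%:Z), (s%:Z, t%:Z)),
      (s%:Z * tp%:Z - sp%:Z * t%:Z = (-1) ^+ (~~ odd k))%R, (0 < t)%N &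
      coth_state n k = (tp %% 8, t %% 8, b)%N] /\ jsym tp t = (-1) ^+ b.
Proof.
elim: k => [|k [sp [tp [s [t [b [[E D t0 S] J]]]]]]].
  exists 1%N, 0%N, n, 1%N, false; rewrite /= cf_ax mul1n /jsym /= jac1.
  by split=> //; split=> //=; rewrite mulr0 mulr1 sub0r expr1.
have co : coprime tp t by exact: det_coprime D.
set a := (k.+1.*2.+1 * n)%N.
exists s, t, (a * s + sp)%N, (a * t + tp)%N, (jstep tp t (a * t + tp) (+) b).
split; last by rewrite jsym_step // J signr_addb.
split.
- by rewrite /= E cf_ax.
- rewrite /= negbK !PoszD !PoszM.
  transitivity (- (s%:Z * tp%:Z - sp%:Z * t%:Z)); first by ring.
  by rewrite D; case: (odd k); rewrite /= ?opprK.
- by rewrite addn_gt0 !muln_gt0 n_gt0 t0.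
have m8 : ((a * (t %% 8) + tp %% 8) %% 8 = (a * t + tp) %% 8)%N.
  by rewrite modnDmr -modnDml modnMmr modnDml.
by rewrite /= S -/a m8 jstep_mod8.
Qed.

Lemma jacobi_seqE k :
  jacobi_seq x k = omap (fun b : bool => (-1) ^+ b) (coth_out n k).
Proof.
have [sp [tp [s [t [b [[E D t0 S] J]]]]]] := cf_conv_state k.
rewrite /jacobi_seq /cf_s /cf_t E /= /jacobi -/(jac s t) /coth_out S.
have -> : odd (t %% 8) = odd t by lia.
have -> : odd (t %% 8)./2 = odd t./2 by lia.
case: ifP => // ot; congr Some; move: J; rewrite /jsym ot => J.
have co : coprimez tp t by exact: det_coprime D.
(* The inserted square of (tp/t) is 1; modulo t the determinant identity then replaces s tp by a
   sign. *)
have -> : jac s t = jac (s%:Z * tp%:Z) t * jac tp t.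
  by rewrite jacMl // -mulrA -expr2 jac_sqr ?mulr1.
rewrite J.
rewrite (jac_mod _ ((-1) ^+ (~~ odd k)) t ot).
  have -> : jac ((-1) ^+ (~~ odd k)) t = (-1) ^+ (~~ odd k && odd t./2).
    case: (odd k); rewrite /= ?expr0 ?expr1; first exact: jac_one.
    exact: jacN1.
  by rewrite -signr_addb addbC.
by rewrite -D opprB addrC subrK dvdz_mull.
Qed.

End Convergents.

(** * Finite verification of the periods *)

Lemma coth_state_mod8 n k : coth_state (n %% 8) k = coth_state n k.
Proof.
elim: k => //= k ->; case: (coth_state n k) => [[p q] b].
suff -> : ((k.+1.*2.+1 * (n %% 8) * q + p) %% 8 = (k.+1.*2.+1 * n * q + p) %% 8)%N by [].
by rewrite -modnDml -modnMml modnMmr modnMml modnDml.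
Qed.

(** The return to the initial state after 24 steps makes 24 indices enough to confirm L; every
    smaller length is refuted at one of them. *)
Definition period_check (n : nat) : bool :=
  let L := (if n %% 4 == 0 then 2 else if n %% 4 == 2 then 8 else 24)%N in
  [&& coth_state n 24 == coth_state n 0,
      all (fun k => coth_out n (k + L) == coth_out n k) (iota 0 24) &
      all (fun L' => has (fun k => coth_out n (k + L') != coth_out n k) (iota 0 24))
        (iota 1 L.-1)].

Lemma period_checkT n : period_check n.
Proof.
have outE k : coth_out (n %% 8) k = coth_out n k.
  by rewrite /coth_out coth_state_mod8.
have -> : period_check n = period_check (n %% 8).
  have n4 : (n %% 8 %% 4 = n %% 4)%N by lia.
  rewrite /period_check !coth_state_mod8 n4; congr [&& _, _ & _].
    by apply: eq_all => k; rewrite !outE.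
  by apply: eq_all => L'; apply: eq_has => k; rewrite !outE.
have : all period_check (iota 0 8) by vm_compute.
by move/allP; apply; rewrite mem_iota ltn_mod.
Qed.

Lemma coth_out_period n k : coth_out n (k + 24) = coth_out n k.
Proof.
rewrite /coth_out oddD addbF; suff -> : coth_state n (k + 24) = coth_state n k by [].
elim: k => [|k IH]; first by have /and3P[/eqP] := period_checkT n.
rewrite addSn /= IH; case: (coth_state n k) => [[p q] b].
suff -> : (((k + 24).+1.*2.+1 * n * q + p) %% 8 = (k.+1.*2.+1 * n * q + p) %% 8)%N by [].
(* Advancing k by 24 adds 48n to the partial quotient, a multiple of 8. *)
have -> : ((k + 24).+1.*2.+1 * n * q + p = 6 * n * q * 8 + (k.+1.*2.+1 * n * q + p))%N by lia.
by rewrite modnMDl.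
Qed.

Lemma coth_out_modn n k : coth_out n (k %% 24) = coth_out n k.
Proof.
rewrite [in RHS](divn_eq k 24) addnC; elim: (_ %/ _)%N => [|m IH]; first by rewrite addn0.
by rewrite mulSn [(24 + _)%N]addnC addnA coth_out_period.
Qed.

Lemma smallest_period_coth_out n :
  smallest_period (coth_out n)
    (if (n %% 4 == 0)%N then 2%N else if (n %% 4 == 2)%N then 8%N else 24%N).
Proof.
have /and3P[_] := period_checkT n; set L := (if _ then _ else _).
move=> /allP HL /allP Hmin; split; [split|].
- by rewrite /L; case: ifP => // _; case: ifP.
- move=> k; rewrite -(coth_out_modn n k) -coth_out_modn -modnDml coth_out_modn.
  by apply/eqP/HL; rewrite mem_iota ltn_mod.
move=> L' [L'1 HL']; rewrite leqNgt; apply/negP => L'L.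
have /hasP[k _ /negP[]] : has (fun k => coth_out n (k + L') != coth_out n k) (iota 0 24).
  by apply: Hmin; rewrite mem_iota L'1; move: L'L; lia.
exact/eqP/HL'.
Qed.

Theorem theorem5 (R : realType) (n : nat) (hn : (1 <= n)%N) :
  let x : R := (expR (2 / n%:R) + 1) / (expR (2 / n%:R) - 1) in
  (exists L, purely_periodic_with (jacobi_seq x) L) /\
  smallest_period (jacobi_seq x)
    (if (n %% 4 == 0)%N then 2%N else if (n %% 4 == 2)%N then 8%N else 24%N).
Proof.
move=> x; set L := (if _ then _ else _).
have cE k : jacobi_seq x k = omap (fun b : bool => (-1) ^+ b) (coth_out n k).
  by apply: jacobi_seqE => // j; have [_] := cf_state_coth R n j hn.
(* Injectivity carries periods of the Jacobi sequence back to [coth_out], which gives minimality. *)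
have inj : injective (omap (fun b : bool => (-1) ^+ b : int)).
  by move=> [[]|] [[]|].
have [[L1 HL] Hmin] := smallest_period_coth_out n; rewrite -/L in L1 HL Hmin.
have PL : purely_periodic_with (jacobi_seq x) L.
  by split=> // k; rewrite !cE HL.
split; [by exists L | split=> // L' [L'1 HL']; apply: Hmin; split=> // k].
by apply: inj; rewrite -!cE.
Qed.
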